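(* Let $\Gamma$ be a commutative group and let $T$ be a commutative refinement $\Gamma$-monoid. Then any two $\Gamma$-series of $T$ have equivalent refinements. Consequently, any two $\Gamma$-composition series of $T$ are equivalent, and if $T$ has a $\Gamma$-composition series, then $T$ determines a unique list of simple $\Gamma$-monoids (the quotients of a $\Gamma$-composition series, unique up to order and $\Gamma$-isomorphism).
   Context: Monoids are commutative, written additively, with identity $0$. A $\Gamma$-monoid is a monoid $T$ with an action $(\alpha,a)\mapsto {}^{\alpha}a$ of the group $\Gamma$ on $T$ such that ${}^{\alpha}(a+b)={}^{\alpha}a+{}^{\alpha}b$. A $\Gamma$-isomorphism is a monoid isomorphism $\phi$ with $\phi({}^{\alpha}a)={}^{\alpha}\phi(a)$. $T$ is refinement if whenever $a+b=c+d$ in $T$ there are $e_1,e_2,e_3,e_4\in T$ with $a=e_1+e_2$, $b=e_3+e_4$, $c=e_1+e_3$, $d=e_2+e_4$. Write $a\le b$ if $b=a+c$ for some $c\in T$. A $\Gamma$-order-ideal of $T$ is a submonoid $I$ of $T$ that is closed under the action of $\Gamma$ and hereditary ($a\le b$ and $b\in I$ imply $a\in I$). A $\Gamma$-monoid $M$ is simple if its only $\Gamma$-order-ideals are $0$ and $M$. For a submonoid $H$ of a monoid $M$, $x\,\rho_H\,y$ means $(x+H)\cap(y+H)\ne\varnothing$; this is an equivalence relation, $\rho_H(x)$ is the class of $x$, and $M/H=\{\rho_H(x):x\in M\}$ is a monoid under $\rho_H(x)+\rho_H(y)=\rho_H(x+y)$. If $H$ is a $\Gamma$-order-ideal of a $\Gamma$-monoid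 $M$, then $\Gamma$ acts on $M/H$ by ${}^{\alpha}\rho_H(x)=\rho_H({}^{\alpha}x)$. A $\Gamma$-series for $T$ is a finite sequence of $\Gamma$-order-ideals $0=I_0\subseteq I_1\subseteq\cdots\subseteq I_n=T$. A refinement of it is a $\Gamma$-series obtained from it by inserting further $\Gamma$-order-ideals between consecutive terms. It is a $\Gamma$-composition series if for each $i=0,\dots,n-1$ we have $I_i\subsetneq I_{i+1}$ and $I_{i+1}/I_i$ is a simple $\Gamma$-monoid. Two series are equivalent if there is a one-to-one correspondence between their quotients $I_{i+1}/I_i$ such that corresponding quotients are $\Gamma$-isomorphic. *)

(* Defs.v *)
From HB Require Import structures.
From mathcomp Require Import all_boot all_algebra.
From mathcomp Require Import boolp classical_sets.

Set Implicit Arguments.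
Unset Strict Implicit.
Unset Printing Implicit Defensive.

Import GRing.Theory.
Local Open Scope classical_set_scope.
Local Open Scope ring_scope.

(* [gact a 0 = 0] is not an axiom: it follows from the others, see [gact0]. *)
HB.mixin Record hasGAction (G : groupType) T of GRing.Nmodule T := {
  gact : G -> T -> T;
  gact1 : forall x, gact 1%g x = x;
  gactM : forall a b x, gact (a * b)%g x = gact a (gact b x);
  gactD : forall a x y, gact a (x + y) = gact a x + gact a y
}.

#[short(type="gmonoidType")]
HB.structure Definition GMonoid (G : groupType) :=
  { T of hasGAction G T & GRing.Nmodule T }.

Definition refinement_monoid (T : nmodType) : Prop :=
  forall a b c d : T, a + b = c + d ->
    exists e1 e2 e3 e4 : T,
      [/\ a = e1 + e2, b = e3 + e4, c = e1 + e3 & d = e2 + e4].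

Definition mle (T : nmodType) (a b : T) : Prop := exists c : T, b = a + c.

Definition gisomorphic (G : groupType) (M N : gmonoidType G) : Prop :=
  exists f : {additive M -> N},
    bijective f /\ forall (a : G) (x : M), f (gact a x) = gact a (f x).

Section GIdeal.
Variables (G : groupType) (T : gmonoidType G).

Lemma gact0 (a : G) : gact a (0 : T) = 0.
Proof.
have E : gact a (gact a^-1%g (0 : T)) = 0 by rewrite -gactM mulgV gact1.
by rewrite -[LHS]addr0 -{2}E -gactD add0r E.
Qed.

Record is_gideal (I : set T) : Prop := IsGIdeal {
  gideal_0 : I 0;
  gideal_D : forall x y, I x -> I y -> I (x + y);
  gideal_act : forall (a : G) x, I x -> I (gact a x);
  gideal_hered : forall x y, mle x y -> I y -> I x
}.

Record gideal := GIdeal { gideal_set :> set T; gidealP : is_gideal gideal_set }.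

HB.instance Definition _ := gen_eqMixin gideal.

Lemma is_gideal_setT : is_gideal [set: T].
Proof. by split. Qed.

Definition gidealT : gideal := GIdeal is_gideal_setT.

End GIdeal.

(* There is no ideal [0] here: [set 0] is hereditary only if T is conical. *)
Definition gsimple (G : groupType) (M : gmonoidType G) : Prop :=
  forall I : gideal M, I = [set 0] :> set M \/ I = [set: M] :> set M.

(* An order-ideal, viewed as a G-monoid in its own right. *)
Section SubGMonoid.
Variables (G : groupType) (T : gmonoidType G) (I : gideal T).

Definition gsub : Type := set_type (gideal_set I).

HB.instance Definition _ := SubChoice.on gsub.

Lemma gsubP (x : gsub) : gideal_set I (\val x).
Proof. exact: set_mem (valP x). Qed.

Definition gsub_of (x : T) (Ix : gideal_set I x) : gsub := exist _ x (mem_set Ix).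

Definition gsub0 : gsub := gsub_of (gideal_0 (gidealP I)).
Definition gsub_add (x y : gsub) : gsub :=
  gsub_of (gideal_D (gidealP I) (gsubP x) (gsubP y)).
Definition gsub_act (a : G) (x : gsub) : gsub :=
  gsub_of (gideal_act (gidealP I) a (gsubP x)).

Lemma gsub_addA : associative gsub_add.
Proof. by move=> x y z; apply: val_inj => /=; rewrite addrA. Qed.
Lemma gsub_addC : commutative gsub_add.
Proof. by move=> x y; apply: val_inj => /=; rewrite addrC. Qed.
Lemma gsub_add0 : left_id gsub0 gsub_add.
Proof. by move=> x; apply: val_inj => /=; rewrite add0r. Qed.

HB.instance Definition _ :=
  GRing.isNmodule.Build gsub gsub_addA gsub_addC gsub_add0.

Lemma gsub_act1 x : gsub_act 1%g x = x.
Proof. by apply: val_inj; rewrite /= gact1. Qed.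
Lemma gsub_actM a b x : gsub_act (a * b)%g x = gsub_act a (gsub_act b x).
Proof. by apply: val_inj; rewrite /= gactM. Qed.
Lemma gsub_actD a (x y : gsub) :
  gsub_act a (x + y) = gsub_act a x + gsub_act a y.
Proof. by apply: val_inj; rewrite /= gactD. Qed.

HB.instance Definition _ :=
  hasGAction.Build G gsub gsub_act1 gsub_actM gsub_actD.

(* If J is contained in I, this is J, viewed as an order-ideal of I. *)
Lemma is_gideal_restr (J : gideal T) : is_gideal [set x : gsub | gideal_set J (\val x)].
Proof.
have [J0 JD Ja Jh] := gidealP J; split=> /=.
- exact: J0.
- by move=> x y; apply: JD.
- by move=> a x; apply: Ja.
- by move=> x y [z ->] /=; apply: Jh; exists (\val z).
Qed.

Definition grestr (J : gideal T) : gideal gsub := GIdeal (is_gideal_restr J).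

End SubGMonoid.

Section Quotient.
Variables (G : groupType) (M : gmonoidType G).

Definition rho (H : set M) (x y : M) : Prop :=
  [set x + h | h in H] `&` [set y + h | h in H] !=set0.

Lemma rhoP (H : set M) (x y : M) :
  rho H x y <-> exists h k, [/\ H h, H k & x + h = y + k].
Proof.
split=> [[_ [[h Hh <-] [k Hk /esym E]]]|[h [k [Hh Hk E]]]]; first by exists h, k.
by exists (x + h); split; [exists h|exists k].
Qed.

Variable H : gideal M.

Definition rhob : rel M := fun x y => `[< rho H x y >].

Lemma rhob_refl : reflexive rhob.
Proof.
move=> x; apply/asboolP/rhoP; exists 0, 0.
by split=> //; apply: gideal_0 (gidealP H).
Qed.
Lemma rhob_sym : symmetric rhob.
Proof. by move=> x y; rewrite /rhob /rho setIC. Qed.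
Lemma rhob_trans : transitive rhob.
Proof.
move=> y x z /asboolP/rhoP[h [k [Hh Hk E]]] /asboolP/rhoP[l [m [Hl Hm F]]].
have HD := gideal_D (gidealP H).
apply/asboolP/rhoP; exists (h + l), (m + k); split; [exact: HD|exact: HD|].
by rewrite addrA E addrAC F addrA.
Qed.

Canonical rho_equiv := EquivRel rhob rhob_refl rhob_sym rhob_trans.

Definition gquot : Type := {eq_quot rho_equiv}%qT.

HB.instance Definition _ := Choice.on gquot.
HB.instance Definition _ := EqQuotient.on gquot.

Local Open Scope quotient_scope.

Definition gquot0 : gquot := \pi_gquot 0.
Definition gquot_add : gquot -> gquot -> gquot := lift_op2 gquot +%R.
Definition gquot_act (a : G) : gquot -> gquot := lift_op1 gquot (gact a).

Lemma pi_gquotD : {morph \pi_gquot : x y / x + y >-> gquot_add x y}.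
Proof.
have HD := gideal_D (gidealP H).
move=> x y; unlock gquot_add; apply/eqmodP/asboolP/rhoP.
have /eqmodP/asboolP/rhoP[h [k [Hh Hk E]]] := reprK (\pi_gquot x).
have /eqmodP/asboolP/rhoP[l [m [Hl Hm F]]] := reprK (\pi_gquot y).
exists (k + m), (h + l); split; [exact: HD|exact: HD|].
by rewrite addrACA -E -F addrACA.
Qed.

Lemma pi_gquot_act (a : G) : {morph \pi_gquot : x / gact a x >-> gquot_act a x}.
Proof.
have Ha := gideal_act (gidealP H).
move=> x; unlock gquot_act; apply/eqmodP/asboolP/rhoP.
have /eqmodP/asboolP/rhoP[h [k [Hh Hk E]]] := reprK (\pi_gquot x).
exists (gact a k), (gact a h); split; [exact: Ha|exact: Ha|].
by rewrite -!gactD E.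
Qed.

Lemma gquot_addA : associative gquot_add.
Proof.
elim/quotW=> x; elim/quotW=> y; elim/quotW=> z.
by rewrite -!pi_gquotD addrA.
Qed.
Lemma gquot_addC : commutative gquot_add.
Proof. by elim/quotW=> x; elim/quotW=> y; rewrite -!pi_gquotD addrC. Qed.
Lemma gquot_add0 : left_id gquot0 gquot_add.
Proof. by elim/quotW=> x; rewrite -pi_gquotD add0r. Qed.

HB.instance Definition _ :=
  GRing.isNmodule.Build gquot gquot_addA gquot_addC gquot_add0.

Lemma gquot_act1 x : gquot_act 1%g x = x.
Proof. by elim/quotW: x => x; rewrite -pi_gquot_act gact1. Qed.
Lemma gquot_actM a b x : gquot_act (a * b)%g x = gquot_act a (gquot_act b x).
Proof. by elim/quotW: x => x; rewrite -!pi_gquot_act gactM. Qed.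
Lemma gquot_actD a (x y : gquot) :
  gquot_act a (x + y) = gquot_act a x + gquot_act a y.
Proof.
elim/quotW: x => x; elim/quotW: y => y.
by rewrite -[RHS]/(gquot_add _ _) -[_ + _ in LHS]/(gquot_add _ _)
           -!(pi_gquotD, pi_gquot_act) gactD.
Qed.

HB.instance Definition _ :=
  hasGAction.Build G gquot gquot_act1 gquot_actM gquot_actD.

End Quotient.

(* [gfactor I J] is I / J; it is only meaningful when J is contained in I. *)
Definition gfactor (G : groupType) (T : gmonoidType G) (I J : gideal T) :
  gmonoidType G := gquot (grestr I J).

(* Finite lists of G-monoids, compared up to order and G-isomorphism. *)
Definition equiv_lists (G : groupType) (m n : nat)
    (L : 'I_m -> gmonoidType G) (L' : 'I_n -> gmonoidType G) : Prop :=
  exists f : 'I_m -> 'I_n,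
    bijective f /\ forall i, gisomorphic (L i) (L' (f i)).

Section Series.
Variables (G : groupType) (T : gmonoidType G).
Implicit Types s t : seq (gideal T).

(* The series I_0, ..., I_n is encoded by the list [:: I_0; ...; I_n], of size
   n + 1; the default value of [nth] is never reached. *)
Definition gterm s (i : nat) : gideal T := nth (gidealT T) s i.

Definition gseries s : Prop :=
  [/\ (0 < size s)%N,
      gterm s 0 = [set 0] :> set T,
      gterm s (size s).-1 = [set: T] :> set T &
      forall i, (i < (size s).-1)%N -> gterm s i `<=` gterm s i.+1].

Definition grefines t s : Prop := gseries t /\ subseq s t.

Definition gfactors s (i : 'I_(size s).-1) : gmonoidType G :=
  gfactor (gterm s i.+1) (gterm s i).

Definition gcomposition_series s : Prop :=
  gseries s /\
  forall i : 'I_(size s).-1,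
    gterm s i `<` gterm s i.+1 /\ gsimple (gfactors i).

Definition gequiv s t : Prop := equiv_lists (@gfactors s) (@gfactors t).

Definition composition_list (n : nat) (L : 'I_n -> gmonoidType G) : Prop :=
  exists2 s, gcomposition_series s & equiv_lists (@gfactors s) L.

End Series.

(* Main.v *)
Require Import Defs.
From HB Require Import structures.
From mathcomp Require Import all_boot all_algebra.
From mathcomp Require Import boolp classical_sets.

(** This is the Schreier refinement theorem and the Jordan-Hoelder theorem for
    the lattice of order-ideals of [T].

    Refinement enters in two places.  It makes the sum of two order-ideals
    hereditary, hence an order-ideal ([is_gideal_sum]); intersection then
    distributes over sum, by heredity ([gcap_sumr]).  And it gives the second
    isomorphism theorem: I / (I cap J) is isomorphic to (I + J) / J
    ([second_isomorphism]).  Distributivity and the second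
    isomorphism theorem together yield Zassenhaus's butterfly lemma
    ([butterfly]): for I' in I and J' in J, both
    (I' + I cap J) / (I' + I cap J') and (J' + J cap I) / (J' + J cap I') are
    isomorphic to (I cap J) / (I' cap J + I cap J').

    Given series I_0, ..., I_p and J_0, ..., J_q, put
    I_{i,j} = I_i + I_{i+1} cap J_j ([rterm]); for fixed i this chain rises from
    I_i to I_{i+1} as j goes from 0 to q.  If p and q are positive, reading the
    I_{i,j} in lexicographic order refines the first series, the symmetric
    construction refines the second, and by the butterfly lemma exchanging i and
    j matches the factors of the two refinements ([schreier_refinement]).

    Uniqueness of composition series needs no refined series.  If
    I_{i+1} / I_i is simple, nothing lies strictly between I_i and I_{i+1}
    ([gsimple_factor]), so the chain I_{i,0}, ..., I_{i,q} jumps exactly once, at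
    some j.  By distributivity I_{i,j} = I_{i,j+1} holds if and only if
    J_{j,i} = J_{j,i+1} does ([grefine_eq_sym]), so the relation that the chain
    of i jumps at j is symmetric in the two series.  It is therefore the graph
    of a bijection, and the butterfly lemma says that the factors so matched are
    isomorphic ([gequiv_composition]). *)

Set Implicit Arguments.
Unset Strict Implicit.
Unset Printing Implicit Defensive.

(** * Isomorphisms of G-monoids *)

Section Isomorphisms.
Import GRing.Theory.
Local Open Scope ring_scope.
Variable G : groupType.
Implicit Types M N P : gmonoidType G.

Lemma gisomorphic_bij M N (f : M -> N) :
  f 0 = 0 -> {morph f : x y / x + y} ->
  (forall a x, f (gact a x) = gact a (f x)) -> bijective f -> gisomorphic M N.
Proof.
move=> f0 fD fa bijf.
pose F := HB.pack_for {additive M -> N} f (GRing.isNmodMorphism.Build M N f (conj f0 fD)).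
by exists F.
Qed.

Lemma gisomorphic_refl M : gisomorphic M M.
Proof. by apply: (@gisomorphic_bij M M id) => //; exists id. Qed.

Lemma gisomorphic_sym M N : gisomorphic M N -> gisomorphic N M.
Proof.
case=> f [[g fK gK] fa]; apply: (@gisomorphic_bij N M g).
- by rewrite -(raddf0 f) fK.
- by move=> x y; apply: (can_inj fK); rewrite raddfD !gK.
- by move=> a x; apply: (can_inj fK); rewrite fa !gK.
- by exists f.
Qed.

Lemma gisomorphic_trans M N P :
  gisomorphic M N -> gisomorphic N P -> gisomorphic M P.
Proof.
move=> [f [bijf fa]] [g [bijg ga]]; apply: (@gisomorphic_bij M P (g \o f)).
- by rewrite /= !raddf0.
- by move=> x y; rewrite /= !raddfD.
- by move=> a x; rewrite /= fa ga.
- exact: bij_comp.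
Qed.

Lemma inj_surj_bij (X Y : Type) (f : X -> Y) :
  injective f -> (forall y, exists x, f x = y) -> bijective f.
Proof.
move=> injf /choice[g gK]; exists g => // x.
by apply: injf; rewrite gK.
Qed.

Lemma equiv_lists_refl n (L : 'I_n -> gmonoidType G) : equiv_lists L L.
Proof. by exists id; split=> [|i]; [exists id|apply: gisomorphic_refl]. Qed.

Lemma equiv_lists_trans m n p (L : 'I_m -> gmonoidType G)
    (L' : 'I_n -> gmonoidType G) (L'' : 'I_p -> gmonoidType G) :
  equiv_lists L L' -> equiv_lists L' L'' -> equiv_lists L L''.
Proof.
move=> [f [bijf isof]] [g [bijg isog]]; exists (g \o f).
by split=> [|i]; [apply: bij_comp|apply: gisomorphic_trans (isof i) (isog _)].
Qed.

End Isomorphisms.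

(** * Order-ideals of a refinement monoid *)

Section Ideals.
Import GRing.Theory.
Local Open Scope classical_set_scope.
Local Open Scope ring_scope.
Variables (G : groupType) (T : gmonoidType G).
Implicit Types I J K : gideal T.

Lemma gideal_eq I J : I `<=` J -> J `<=` I -> I = J.
Proof.
move=> IJ JI; have := conj IJ JI => /seteqP.
case: I J {IJ JI} => [I Iid] [J Jid] /= E; rewrite E in Iid *.
by congr GIdeal; apply: Prop_irrelevance.
Qed.

(** The form in which heredity is used: a summand of a member is a member. *)
Lemma gidealW I x y : gideal_set I (x + y) -> gideal_set I x.
Proof. by apply: (gideal_hered (gidealP I)); exists y. Qed.

Lemma is_gideal_cap I J : is_gideal (I `&` J).
Proof.
have [I0 ID Ia Ih] := gidealP I; have [J0 JD Ja Jh] := gidealP J; split=> //.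
- by move=> x y [? ?] [? ?]; split; [apply: ID|apply: JD].
- by move=> a x [? ?]; split; [apply: Ia|apply: Ja].
- by move=> x y xy [? ?]; split; [apply: Ih xy _|apply: Jh xy _].
Qed.

(** The intersection of two order-ideals. *)
Definition gcap I J : gideal T := GIdeal (is_gideal_cap I J).

Lemma gcapC I J : gcap I J = gcap J I.
Proof. by apply: gideal_eq => x []. Qed.

Hypothesis refT : refinement_monoid T.

Lemma is_gideal_sum I J :
  is_gideal [set x | exists a b, [/\ gideal_set I a, gideal_set J b & x = a + b]].
Proof.
have [I0 ID Ia Ih] := gidealP I; have [J0 JD Ja Jh] := gidealP J; split=> /=.
- by exists 0, 0; rewrite addr0.
- move=> _ _ [a [b [? ? ->]]] [c [d [? ? ->]]]; exists (a + c), (b + d).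
  by split; [apply: ID|apply: JD|rewrite addrACA].
- move=> g _ [a [b [? ? ->]]]; exists (gact g a), (gact g b).
  by split; [apply: Ia|apply: Ja|rewrite gactD].
- move=> x _ [y ->] [a [b [Aa Bb /refT[e1 [e2 [e3 [e4 [E1 _ E3 E4]]]]]]]].
  exists e1, e2; split=> //.
    by apply: (@gidealW I _ e3); rewrite -E3.
  by apply: (@gidealW J _ e4); rewrite -E4.
Qed.

(** The sum of two order-ideals. *)
Definition gsum I J : gideal T := GIdeal (is_gideal_sum I J).

Lemma gsum_subl I J : I `<=` gsum I J.
Proof.
by move=> x Ix; exists x, 0; rewrite addr0; split=> //; apply: gideal_0 (gidealP J).
Qed.

Lemma gsumC I J : gsum I J = gsum J I.
Proof.
by apply: gideal_eq => _ [a [b [? ? ->]]]; exists b, a; rewrite addrC.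
Qed.

Lemma gsum_subr I J : J `<=` gsum I J.
Proof. by rewrite gsumC; apply: gsum_subl. Qed.

Lemma gsum_min I J K : I `<=` K -> J `<=` K -> gsum I J `<=` K.
Proof.
move=> IK JK _ [a [b [Ia Jb ->]]].
by apply: (gideal_D (gidealP K)); [apply: IK|apply: JK].
Qed.

Lemma gsum_idl I J : J `<=` I -> gsum I J = I.
Proof.
move=> JI; apply: gideal_eq; last exact: gsum_subl.
exact: gsum_min.
Qed.

Lemma gsumS I J I' J' : I `<=` I' -> J `<=` J' -> gsum I J `<=` gsum I' J'.
Proof.
move=> II JJ; apply: gsum_min.
  by apply: subset_trans II _; apply: gsum_subl.
by apply: subset_trans JJ _; apply: gsum_subr.
Qed.

Lemma gcap_sumr K I J : gcap K (gsum I J) = gsum (gcap K I) (gcap K J).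
Proof.
apply: gideal_eq => [x [Kx [a [b [Ia Jb E]]]]|].
  move: Kx; rewrite E => Kab; exists a, b; split=> //; split=> //.
    exact: gidealW Kab.
  by rewrite addrC in Kab; apply: gidealW Kab.
apply: gsum_min => x [Kx ?]; split=> //.
  exact: gsum_subl.
exact: gsum_subr.
Qed.

Local Open Scope quotient_scope.

Lemma gquot_eq (M : gmonoidType G) (H : gideal M) (x y : M) :
  \pi_(gquot H) x = \pi_(gquot H) y <->
  exists h k, [/\ gideal_set H h, gideal_set H k & x + h = y + k].
Proof.
rewrite -rhoP; split=> [/eqmodP/asboolP//|?].
by apply/eqmodP/asboolP.
Qed.

(** The map is induced by the inclusion of [I] in [I + J].  It is injective
    because an equality x + h = y + k with x, y in [I] and h, k in [J]
    can be corrected, by refining it, to one with h and k in both ideals. *)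
Lemma second_isomorphism I J :
  gisomorphic (gfactor I (gcap I J)) (gfactor (gsum I J) J).
Proof.
have subI (x : gsub I) : gideal_set (gsum I J) (\val x) by apply/gsum_subl/gsubP.
pose inc (x : gsub I) : gsub (gsum I J) := gsub_of (subI x).
pose f (q : gfactor I (gcap I J)) : gfactor (gsum I J) J :=
  \pi_(gquot (grestr (gsum I J) J)) (inc (repr q)).
have fpi x : f (\pi_(gquot (grestr I (gcap I J))) x)
    = \pi_(gquot (grestr (gsum I J) J)) (inc x).
  apply/gquot_eq.
  have /gquot_eq[h [k [[_ Jh] [_ Jk] /(congr1 \val) E]]] :=
    reprK (\pi_(gquot (grestr I (gcap I J))) x).
  by exists (inc h), (inc k); split=> //; apply: val_inj.
apply: (@gisomorphic_bij G _ _ f).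
- rewrite (fpi 0) -[RHS]/(\pi_(gquot _) 0); congr (\pi _); exact: val_inj.
- elim/quotW => x; elim/quotW => y.
  rewrite !fpi -[X in f X]pi_gquotD fpi -[RHS]pi_gquotD.
  congr (\pi _); exact: val_inj.
- move=> a; elim/quotW => x; rewrite -[X in f X]pi_gquot_act !fpi.
  rewrite -[RHS]pi_gquot_act.
  congr (\pi _); exact: val_inj.
apply: inj_surj_bij.
- elim/quotW => x; elim/quotW => y; rewrite !fpi.
  (* With x = e1 + e2, h = e3 + e4, y = e1 + e3 and k = e2 + e4, one has
     x + e3 = y + e2, where e2 and e3 lie in the intersection. *)
  move=> /gquot_eq[h [k [Jh Jk /(congr1 \val)/= /refT]]].
  move=> [e1 [e2 [e3 [e4 [Ex Eh Ey Ek]]]]].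
  have Ie2 : gideal_set I e2 by apply: (@gidealW _ _ e1); rewrite addrC -Ex; apply: gsubP.
  have Ie3 : gideal_set I e3 by apply: (@gidealW _ _ e1); rewrite addrC -Ey; apply: gsubP.
  have Je2 : gideal_set J e2 by apply: (@gidealW _ _ e4); rewrite -Ek.
  have Je3 : gideal_set J e3 by apply: (@gidealW _ _ e4); rewrite -Eh.
  apply/gquot_eq; exists (gsub_of Ie3), (gsub_of Ie2); split=> //=.
  by apply: val_inj; rewrite /= Ex Ey addrAC.
- elim/quotW => x; have [a [b [Ia Jb E]]] := gsubP x.
  exists (\pi_(gquot (grestr I (gcap I J))) (gsub_of Ia)); rewrite fpi.
  apply/gquot_eq; exists (gsub_of (@gsum_subr I J b Jb)), 0.
  split=> //=; first exact: gideal_0 (gidealP J).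
  by apply: val_inj; rewrite /= E addr0.
Qed.

(** The ideal [I' + (I cap J)], which lies between [I'] and [I] when [I']
    is contained in [I]. *)
Definition grefine I' I J : gideal T := gsum I' (gcap I J).

Lemma grefineS I' I J J' : J `<=` J' -> grefine I' I J `<=` grefine I' I J'.
Proof. by move=> JJ; apply: gsumS => // x [? /JJ]. Qed.

(** The denominator on the left is symmetric in the two pairs of ideals, which
    is what makes [butterfly] follow by exchanging them. *)
Lemma butterfly_half I I' J J' : I' `<=` I -> J' `<=` J ->
  gisomorphic (gfactor (gcap I J) (gsum (gcap I' J) (gcap I J')))
    (gfactor (grefine I' I J) (grefine I' I J')).
Proof.
move=> I'I J'J; have := second_isomorphism (gcap I J) (grefine I' I J').
have -> : gsum (gcap I J) (grefine I' I J') = grefine I' I J.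
  apply: gideal_eq.
    apply: gsum_min; first exact: gsum_subr.
    exact: grefineS.
  rewrite gsumC; apply: gsumS => //; exact: gsum_subl.
suff -> : gcap (gcap I J) (grefine I' I J') = gsum (gcap I' J) (gcap I J') by [].
rewrite gcap_sumr; congr gsum; apply: gideal_eq => x [].
- by move=> [? ?] ?.
- by move=> I'x Jx; split=> //; split=> //; apply: I'I.
- by move=> [? ?] [].
- by move=> Ix J'x; split=> //; split=> //; apply: J'J.
Qed.

(** Zassenhaus's lemma. *)
Lemma butterfly I I' J J' : I' `<=` I -> J' `<=` J ->
  gisomorphic (gfactor (grefine I' I J) (grefine I' I J'))
    (gfactor (grefine J' J I) (grefine J' J I')).
Proof.
move=> I'I J'J; apply: gisomorphic_trans (butterfly_half J'J I'I).
apply: gisomorphic_sym; have := butterfly_half I'I J'J.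
by rewrite gsumC (gcapC I J) (gcapC I J') (gcapC I' J).
Qed.

(** The image of [J] in [K / I] is an order-ideal, and [J] is recovered from it
    because [J] contains [I]. *)
Lemma gsimple_factor I J K : I `<=` J -> J `<=` K -> gsimple (gfactor K I) ->
  J = I \/ J = K.
Proof.
move=> IJ JK simK.
pose Q : set (gfactor K I) :=
  [set q | exists2 x : gsub K, gideal_set J (\val x) & q = \pi_(gquot (grestr K I)) x].
have [J0 JD Ja Jh] := gidealP J.
have QP : is_gideal Q.
  split.
  - by exists 0.
  - move=> _ _ [x Jx ->] [y Jy ->]; exists (x + y); first exact: JD.
    by rewrite pi_gquotD.
  - move=> a _ [x Jx ->]; exists (gact a x); first exact: Ja.
    by rewrite pi_gquot_act.
  - elim/quotW => x _ [r -> [z Jz]]; elim/quotW: r => y.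
    rewrite -[_ + _]pi_gquotD => /gquot_eq[h [k [Ih Ik /(congr1 \val)/= E]]].
    exists x => //; apply: (@gidealW J _ (\val y + \val h)).
    by rewrite addrA E; apply: JD => //; apply: IJ.
have [/= QE|/= QE] := simK (GIdeal QP); [left|right]; apply: gideal_eq => //.
- move=> x Jx; have : Q (\pi_(gquot (grestr K I)) (gsub_of (JK _ Jx))).
    by exists (gsub_of (JK _ Jx)).
  rewrite QE => /gquot_eq[h [k [Ih Ik /(congr1 \val)/= E]]].
  by apply: (@gidealW I _ (\val h)); rewrite E add0r.
- move=> x Kx; have : Q (\pi_(gquot (grestr K I)) (gsub_of Kx)) by rewrite QE.
  case=> y Jy /gquot_eq[h [k [Ih Ik /(congr1 \val)/= E]]].
  by apply: (@gidealW J _ (\val h)); rewrite E; apply: JD => //; apply: IJ.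
Qed.

(** Either equality says that [I cap J] is contained in
    [(I' cap J) + (I cap J')], a condition symmetric in the two pairs. *)
Lemma grefine_eq_sym I I' J J' : I' `<=` I -> J' `<=` J ->
  grefine I' I J = grefine I' I J' -> grefine J' J I = grefine J' J I'.
Proof.
move=> I'I J'J E; apply: gideal_eq; last exact: grefineS.
apply: gsum_min; first exact: gsum_subl.
move=> x [Jx Ix].
have : gideal_set (gcap J (grefine I' I J')) x.
  by split=> //; rewrite -E; apply: gsum_subr.
rewrite gcap_sumr; apply: gsum_min => y [Jy].
  by move=> I'y; apply: gsum_subr.
by move=> [_ J'y]; apply: gsum_subl.
Qed.

End Ideals.

(** * Series and their Schreier refinements *)

Section Series.
Local Open Scope classical_set_scope.
Variables (G : groupType) (T : gmonoidType G).
Implicit Types s t : seq (gideal T).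

(** The default value of [gterm] is the top ideal, so that a series may be
    thought of as continuing with the constant value [T] past its end. *)
Lemma gterm_default s i : ((size s).-1 < i)%N -> gterm s i = gidealT T.
Proof. by move=> si; apply: nth_default; apply: leq_trans (leqSpred _) si. Qed.

Lemma gterm_le s i j : gseries s -> (i <= j)%N -> gterm s i `<=` gterm s j.
Proof.
case=> s0 _ _ sS /subnK <-; elim: (j - i)%N => [|k IHk] //.
apply: subset_trans IHk _; rewrite addSn.
have [|ks] := ltnP (k + i) (size s).-1; first exact: sS.
by rewrite [gterm s _.+1]gterm_default.
Qed.

Lemma gterm_bot s (I : gideal T) : gseries s -> gterm s 0 `<=` I.
Proof. by case=> _ -> _ _ _ ->; apply: gideal_0 (gidealP I). Qed.

Lemma gterm_top s i : gseries s -> ((size s).-1 <= i)%N -> gterm s i = gidealT T.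
Proof.
move=> ss si; apply: gideal_eq => // x _; apply: (gterm_le ss si).
by have [_ _ -> _] := ss.
Qed.

(** Repeating the first term ensures that a series has at least one factor. *)
Lemma gseries_dup s : gseries s -> gseries (gterm s 0 :: s).
Proof.
move=> ss; have [s0 sb st sS] := ss; split=> //.
  by rewrite /= -(prednK s0).
by case=> [_|i _]; [move=> x|exact: (gterm_le ss (leqnSn i))].
Qed.

(** Equivalence of series from a bijection given on natural numbers. *)
Lemma gequiv_nat s t (f g : nat -> nat) :
  (forall i, (i < (size s).-1)%N ->
     [/\ (f i < (size t).-1)%N, g (f i) = i &
       gisomorphic (gfactor (gterm s i.+1) (gterm s i))
         (gfactor (gterm t (f i).+1) (gterm t (f i)))]) ->
  (forall j, (j < (size t).-1)%N -> (g j < (size s).-1)%N /\ f (g j) = j) ->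
  gequiv s t.
Proof.
move=> fP gP.
have fb (i : 'I_(size s).-1) : (f i < (size t).-1)%N by case: (fP i (ltn_ord i)).
have gb (j : 'I_(size t).-1) : (g j < (size s).-1)%N by case: (gP j (ltn_ord j)).
exists (fun i => Ordinal (fb i)); split; last first.
  by move=> i; case: (fP i (ltn_ord i)).
exists (fun j => Ordinal (gb j)) => i; apply: val_inj => /=.
  by case: (fP i (ltn_ord i)).
by case: (gP i (ltn_ord i)).
Qed.

Hypothesis refT : refinement_monoid T.

(** The ideal I_{i,j} obtained by cutting the i-th step of [s] by the j-th term
    of [t]. *)
Definition rterm s t i j : gideal T :=
  grefine refT (gterm s i) (gterm s i.+1) (gterm t j).

Section Rterm.
Variables s t : seq (gideal T).
Hypotheses (ss : gseries s) (st : gseries t).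

Lemma rterm_le i j k : (j <= k)%N -> rterm s t i j `<=` rterm s t i k.
Proof. by move=> jk; apply/grefineS/(gterm_le st). Qed.

Lemma rterm_ge i j : gterm s i `<=` rterm s t i j.
Proof. exact: gsum_subl. Qed.

Lemma rterm_leS i j : rterm s t i j `<=` gterm s i.+1.
Proof. by apply: gsum_min => [|x []//]; apply: (gterm_le ss). Qed.

Lemma rterm0 i : rterm s t i 0 = gterm s i.
Proof. by apply: gsum_idl => x [_ /(gterm_bot (gterm s i) st)]. Qed.

Lemma rterm_top i : rterm s t i (size t).-1 = gterm s i.+1.
Proof.
apply: gideal_eq; first exact: rterm_leS.
by move=> x Ix; apply: gsum_subr; split=> //; rewrite gterm_top.
Qed.

Lemma rterm_iso i j :
  gisomorphic (gfactor (rterm s t i j.+1) (rterm s t i j))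
    (gfactor (rterm t s j i.+1) (rterm t s j i)).
Proof. by apply: butterfly; apply: gterm_le. Qed.

End Rterm.

(** The refinement of [s] by [t]: the ideals I_{i,j} in lexicographic order,
    with i < p and j < q, where p and q are the numbers of factors of [s] and
    [t].  If q > 0, the last entry, at position p * q, is I_{p,0}, which is
    [T] when [s] is a series. *)
Definition schreier s t : seq (gideal T) :=
  mkseq (fun k => rterm s t (k %/ (size t).-1) (k %% (size t).-1))
    ((size s).-1 * (size t).-1).+1.

Section Schreier.
Variables s t : seq (gideal T).
Hypotheses (ss : gseries s) (st : gseries t).
Hypotheses (t_gt0 : (0 < (size t).-1)%N).
Let p := (size s).-1.
Let q := (size t).-1.

Lemma size_schreier : (size (schreier s t)).-1 = (p * q)%N.
Proof. by rewrite size_mkseq. Qed.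

Lemma gterm_schreier k : (k <= p * q)%N ->
  gterm (schreier s t) k = rterm s t (k %/ q) (k %% q).
Proof. by move=> kpq; rewrite /gterm nth_mkseq. Qed.

(** The bound [j <= q] is not strict: I_{i,q} and I_{i+1,0} occupy the same
    position, and are both equal to I_{i+1}. *)
Lemma gterm_schreierM i j : (j <= q)%N -> (i * q + j <= p * q)%N ->
  gterm (schreier s t) (i * q + j) = rterm s t i j.
Proof.
rewrite leq_eqVlt => /orP[/eqP->|jq] le; rewrite gterm_schreier //.
  by rewrite addnC -mulSn mulnK // modnMl rterm0 // rterm_top.
by rewrite divnMDl // divn_small // addn0 modnMDl modn_small.
Qed.

Lemma gterm_schreierS k : (k < p * q)%N ->
  gterm (schreier s t) k.+1 = rterm s t (k %/ q) (k %% q).+1.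
Proof.
move=> kpq; rewrite -gterm_schreierM ?addnS -?divn_eq //.
exact: ltn_pmod.
Qed.

Lemma gseries_schreier : gseries (schreier s t).
Proof.
split; first by rewrite size_mkseq.
- by rewrite gterm_schreier // div0n mod0n rterm0 //; case: ss.
- rewrite size_schreier -[X in gterm _ X]addn0 gterm_schreierM ?addn0 //.
  by rewrite rterm0 // gterm_top.
move=> k; rewrite size_schreier => kpq.
rewrite gterm_schreierS // gterm_schreier 1?ltnW //; exact: rterm_le.
Qed.

(** The terms of [s] are those in the positions that are multiples of q. *)
Lemma sub_schreier : subseq s (schreier s t).
Proof.
have sE : s = [seq gterm (schreier s t) k | k <- [seq i * q | i <- iota 0 p.+1]].
  have sp : size s = p.+1 by case: ss => s0 _ _ _; rewrite prednK.
  apply: (@eq_from_nth _ (gidealT T)); first by rewrite !size_map size_iota.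
  move=> i; rewrite sp => ip; rewrite -map_comp (nth_map 0%N) ?size_iota //.
  rewrite nth_iota // add0n /= -[(i * q)%N]addn0 gterm_schreierM ?rterm0 //.
  by rewrite addn0 leq_mul2r -ltnS ip orbT.
rewrite {1}sE [X in subseq _ X](_ : _ =
    [seq gterm (schreier s t) k | k <- iota 0 (p * q).+1]); last first.
  apply/eq_in_map => k; rewrite mem_iota add0n ltnS => /andP[_ kpq].
  by rewrite gterm_schreier.
apply: map_subseq.
rewrite [X in subseq X _](_ : _ = [seq k <- iota 0 (p * q).+1 | q %| k]).
  exact: filter_subseq.
apply: (irr_sorted_eq ltn_trans ltnn).
- rewrite sorted_map; apply: sub_sorted (iota_ltn_sorted 0 p.+1) => i j /=.
  by rewrite ltn_pmul2r.
- by apply: sorted_filter; [exact: ltn_trans|exact: iota_ltn_sorted].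
move=> k; rewrite mem_filter mem_iota add0n ltnS; apply/mapP/andP.
  move=> [i]; rewrite mem_iota add0n ltnS => /andP[_ ip] ->.
  by rewrite dvdn_mull //= leq_mul2r ip orbT.
move=> [/dvdnP[i ->]] /andP[_ ipq]; exists i => //.
by rewrite mem_iota add0n ltnS /= -(leq_pmul2r t_gt0).
Qed.

End Schreier.

Lemma gequiv_schreier s t : gseries s -> gseries t ->
  (0 < (size s).-1)%N -> (0 < (size t).-1)%N ->
  gequiv (schreier s t) (schreier t s).
Proof.
move=> ss st p0 q0; set p := (size s).-1 in p0; set q := (size t).-1 in q0.
(* The factor in position [i * q + j] is sent to the one in [j * p + i]. *)
have swap a b k : (0 < a)%N -> (0 < b)%N -> (k < a * b)%N ->
    let l := (k %% b * a + k %/ b)%N in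
    [/\ (l < b * a)%N, l %/ a = k %% b & l %% a = k %/ b].
  move=> a0 b0 kab; have dk : (k %/ b < a)%N by rewrite ltn_divLR.
  split; last 2 first.
  - by rewrite divnMDl // divn_small // addn0.
  - by rewrite modnMDl modn_small.
  rewrite (@leq_trans ((k %% b).+1 * a)) //; last by rewrite leq_mul2r ltn_mod b0 orbT.
  by rewrite mulSn addnC ltn_add2r.
pose f k := (k %% q * p + k %/ q)%N; pose g l := (l %% p * q + l %/ p)%N.
apply: (@gequiv_nat _ _ f g); rewrite !size_schreier //.
  move=> k kpq; have [lpq ld lm] := swap _ _ _ p0 q0 kpq; split=> //.
    by rewrite /g /f ld lm -divn_eq.
  rewrite !gterm_schreierS // !gterm_schreier 1?ltnW //.
  by rewrite ld lm; apply: rterm_iso.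
move=> l lqp; have [kpq kd km] := swap _ _ _ q0 p0 lqp; split=> //.
by rewrite /f /g kd km -divn_eq.
Qed.

(** The first term of each series is repeated before refining, because a
    series without factors cannot be used to index a refinement of the other. *)
Lemma schreier_refinement s t : gseries s -> gseries t ->
  exists s' t', [/\ grefines s' s, grefines t' t & gequiv s' t'].
Proof.
move=> ss st; pose s2 := gterm s 0 :: s; pose t2 := gterm t 0 :: t.
have [ss2 st2] : gseries s2 /\ gseries t2 by split; apply: gseries_dup.
have [s0 t0] : (0 < (size s2).-1)%N /\ (0 < (size t2).-1)%N.
  by case: ss; case: st.
exists (schreier s2 t2), (schreier t2 s2); split.
- split; first exact: gseries_schreier.
  exact: subseq_trans (subseq_cons _ _) (sub_schreier ss2 st2 t0).
- split; first exact: gseries_schreier.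
  exact: subseq_trans (subseq_cons _ _) (sub_schreier st2 ss2 s0).
- exact: gequiv_schreier.
Qed.

(** * Composition series *)

(** The chain I_{i,0}, ..., I_{i,q} goes from I_i to I_{i+1} in a single step,
    from the index [j] to the next. *)
Definition linked s t i j : Prop :=
  rterm s t i j = gterm s i /\ rterm s t i j.+1 = gterm s i.+1.

Lemma rterm_simple s t i j : gcomposition_series s -> gseries t ->
  (i < (size s).-1)%N -> rterm s t i j = gterm s i \/ rterm s t i j = gterm s i.+1.
Proof.
move=> [ss sc] st ip; have [_] := sc (Ordinal ip).
by apply: gsimple_factor; [apply: rterm_ge|apply: rterm_leS].
Qed.

Lemma gterm_neq s i : gcomposition_series s -> (i < (size s).-1)%N ->
  gterm s i <> gterm s i.+1.
Proof. by move=> [_ sc] ip E; have [[]] := sc (Ordinal ip); rewrite /= E. Qed.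

(** The jump is just before the first index where the chain reaches I_{i+1}. *)
Lemma linked_exists s t i : gcomposition_series s -> gseries t ->
  (i < (size s).-1)%N -> exists2 j, (j < (size t).-1)%N & linked s t i j.
Proof.
move=> cs st ip; have neq := gterm_neq cs ip.
have [ss _] := cs.
pose P j := `[< rterm s t i j = gterm s i.+1 >].
have exP : exists j, P j by exists (size t).-1; apply/asboolP/rterm_top.
case: (ex_minnP exP) => -[|j] /asboolP Pj minj; first by rewrite rterm0 in Pj.
exists j; first by apply: minj; apply/asboolP/rterm_top.
split=> //; case: (rterm_simple j cs st ip) => // E.
by have /minj := asboolT E; rewrite ltnn.
Qed.

Lemma linked_sym s t i j : gcomposition_series s -> gcomposition_series t ->
  (i < (size s).-1)%N -> (j < (size t).-1)%N -> linked s t i j -> linked t s j i.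
Proof.
move=> cs ct ip jq [E1 E2]; have [[ss _] [st _]] := (cs, ct).
have neq : rterm t s j i <> rterm t s j i.+1.
  move=> /esym E; apply: (gterm_neq cs ip); rewrite -E1 -E2; apply/esym.
  by apply: grefine_eq_sym E; apply: gterm_le.
have le : rterm t s j i `<=` rterm t s j i.+1 by apply: rterm_le.
case: (rterm_simple i ct ss jq) (rterm_simple i.+1 ct ss jq) => F1 [] F2 //.
- by rewrite F1 F2 in neq.
- by case: neq; apply: gideal_eq => //; rewrite F1 F2; apply: (gterm_le st).
- by rewrite F1 F2 in neq.
Qed.

Lemma linked_inj s t i j k : gcomposition_series s -> gseries t ->
  (i < (size s).-1)%N -> linked s t i j -> linked s t i k -> j = k.
Proof.
move=> cs st ip; have [ss _] := cs.
wlog jk : j k / (j <= k)%N => [WL Lj Lk|[_ Ej] [Ek _]].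
  by case/orP: (leq_total j k) => /WL; [apply|move=> H; apply/esym/H].
move: jk; rewrite leq_eqVlt => /orP[/eqP//|jk].
case: (gterm_neq cs ip); apply: gideal_eq; first exact: (gterm_le ss).
by rewrite -Ej -Ek; apply: rterm_le.
Qed.

Lemma linked_iso s t i j : gseries s -> gseries t ->
  linked s t i j -> linked t s j i ->
  gisomorphic (gfactor (gterm s i.+1) (gterm s i))
    (gfactor (gterm t j.+1) (gterm t j)).
Proof.
by move=> ss st [<- <-] [<- <-]; apply: rterm_iso.
Qed.

Lemma gequiv_composition s t : gcomposition_series s -> gcomposition_series t ->
  gequiv s t.
Proof.
move=> cs ct; have [[ss _] [st _]] := (cs, ct).
have ex u v : gcomposition_series u -> gseries v -> forall i : 'I_(size u).-1,
    exists j : 'I_(size v).-1, linked u v i j.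
  move=> cu sv i; have [j jv L] := linked_exists cu sv (ltn_ord i).
  by exists (Ordinal jv).
have [f fP] := choice (ex s t cs st); have [g gP] := choice (ex t s ct ss).
exists f; split=> [|i].
  exists g => [i|j]; apply: val_inj.
    by apply: (linked_inj ct ss _ (gP (f i))) => //; apply: linked_sym (fP i).
  by apply: (linked_inj cs st _ (fP (g j))) => //; apply: linked_sym (gP j).
by apply: linked_iso (fP i) _ => //; apply: linked_sym (fP i).
Qed.

End Series.

Theorem theorem3p25 (G : groupType) (T : gmonoidType G)
    (commG : forall a b : G, (a * b = b * a)%g)
    (refT : refinement_monoid T) :
  [/\ (forall s t : seq (gideal T), gseries s -> gseries t ->
         exists s' t' : seq (gideal T),
           [/\ grefines s' s, grefines t' t & gequiv s' t']),
      (forall s t : seq (gideal T),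
         gcomposition_series s -> gcomposition_series t -> gequiv s t) &
      (exists s : seq (gideal T), gcomposition_series s) ->
         exists (n : nat) (L : 'I_n -> gmonoidType G),
           [/\ (forall i, gsimple (L i)),
               composition_list T L &
               forall (m : nat) (L' : 'I_m -> gmonoidType G),
                 composition_list T L' -> equiv_lists L L']].
Proof.
split=> [s t|s t|[s cs]]; first exact: schreier_refinement.
  exact: gequiv_composition.
exists (size s).-1, (@gfactors G T s); split.
- by move=> i; have [_ /(_ i)[]] := cs.
- by exists s => //; apply: equiv_lists_refl.
- move=> m L' [t ct tL']; apply: equiv_lists_trans tL'.
  exact: gequiv_composition.
Qed.
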